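(* The para-octonionic projective plane $\mathbb O'P^2=\mathcal U/_\sim$, with charts $U_1/_\sim\ni[1,u,v]\mapsto(u,v)$, $U_2/_\sim\ni[u,1,v]\mapsto(u,v)$, $U_3/_\sim\ni[u,v,1]\mapsto(u,v)$ (each onto the open set $\{(u,v)\in\mathbb O'^2:1+|u|^2+|v|^2>0\}$), is a $16$-dimensional simply connected manifold.
   Context: Para-octonions $\mathbb O'=\mathbb H\oplus\mathbb H$ with product $(q_1,q_2)(p_1,p_2)=(q_1p_1+\bar p_2q_2,\ p_2q_1+q_2\bar p_1)$, conjugation $\overline{(q_1,q_2)}=(\bar q_1,-q_2)$, $\langle a,b\rangle=\mathrm{Re}(a\bar b)$, $|a|^2=\langle a,a\rangle=|q_1|^2-|q_2|^2$. Let $\mathbb O'_+=\{x:|x|^2>0\}$, $U_1=\{(1,y,z):1+|y|^2+|z|^2>0\}$, $U_2=\{(x,1,z):|x|^2+1+|z|^2>0\}$, $U_3=\{(x,y,1):|x|^2+|y|^2+1>0\}$, $\mathcal U=U_1\cup U_2\cup U_3$, and $[a,b,c]\sim[d,e,f]$ iff $(a,b,c)=(d\lambda,e\lambda,f\lambda)$ for some $\lambda\in\mathbb O'_+$ (an equivalence relation on $\mathcal U$). *)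

(* Defs.v *)
From mathcomp Require Import all_boot all_order all_algebra.
From mathcomp Require Import all_classical all_reals all_analysis.
Import numFieldNormedType.Exports.
Set Implicit Arguments.
Unset Strict Implicit.
Unset Printing Implicit Defensive.
Import Order.TTheory GRing.Theory Num.Theory.
Local Open Scope classical_set_scope.
Local Open Scope ring_scope.

Section ParaOctonions.
Variable R : realType.

(* Quaternions: (a,b,c,d) stands for a + b i + c j + d k. *)
Definition quat := (R * R * R * R)%type.

Definition qadd (p q : quat) : quat :=
  let '(a1, b1, c1, d1) := p in let '(a2, b2, c2, d2) := q in
  (a1 + a2, b1 + b2, c1 + c2, d1 + d2).

Definition qopp (p : quat) : quat :=
  let '(a, b, c, d) := p in (- a, - b, - c, - d).

Definition qmul (p q : quat) : quat :=
  let '(a1, b1, c1, d1) := p in let '(a2, b2, c2, d2) := q in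
  (a1 * a2 - b1 * b2 - c1 * c2 - d1 * d2,
   a1 * b2 + b1 * a2 + c1 * d2 - d1 * c2,
   a1 * c2 - b1 * d2 + c1 * a2 + d1 * b2,
   a1 * d2 + b1 * c2 - c1 * b2 + d1 * a2).

Definition qconj (p : quat) : quat :=
  let '(a, b, c, d) := p in (a, - b, - c, - d).

Definition qre (p : quat) : R := let '(a, _, _, _) := p in a.

Definition poct := (quat * quat)%type.

Definition omul (x y : poct) : poct :=
  let '(q1, q2) := x in let '(p1, p2) := y in
  (qadd (qmul q1 p1) (qmul (qconj p2) q2), qadd (qmul p2 q1) (qmul q2 (qconj p1))).

Definition oconj (x : poct) : poct := let '(q1, q2) := x in (qconj q1, qopp q2).

Definition ore (x : poct) : R := qre x.1.

Definition oinner (a b : poct) : R := ore (omul a (oconj b)).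

Definition onorm2 (a : poct) : R := oinner a a.

Definition oone : poct := ((1, 0, 0, 0), (0, 0, 0, 0)).

Definition Opos : set poct := [set x | 0 < onorm2 x].

Definition otriple := (poct * poct * poct)%type.

Definition U1 : set otriple :=
  [set t | t.1.1 = oone /\ 0 < 1 + onorm2 t.1.2 + onorm2 t.2].
Definition U2 : set otriple :=
  [set t | t.1.2 = oone /\ 0 < onorm2 t.1.1 + 1 + onorm2 t.2].
Definition U3 : set otriple :=
  [set t | t.2 = oone /\ 0 < onorm2 t.1.1 + onorm2 t.1.2 + 1].
Definition Ucal : set otriple := U1 `|` U2 `|` U3.

Definition proj_equiv (s t : otriple) : Prop :=
  exists l, Opos l /\ s.1.1 = omul t.1.1 l /\ s.1.2 = omul t.1.2 l
                   /\ s.2 = omul t.2 l.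

Definition chart_range : set (poct * poct) :=
  [set w | 0 < 1 + onorm2 w.1 + onorm2 w.2].

Definition unit_I : set R := `[0, 1]%classic.

End ParaOctonions.

Inductive chart_index := chart1 | chart2 | chart3.

(* Inverses of the three charts: (u,v) |-> [1,u,v], [u,1,v], [u,v,1]
   (pi is the quotient map U -> U/~). *)
Definition chart_inv (R : realType) (X : Type) (pi : otriple R -> X)
    (i : chart_index) (w : poct R * poct R) : X :=
  match i with
  | chart1 => pi (@oone R, w.1, w.2)
  | chart2 => pi (w.1, @oone R, w.2)
  | chart3 => pi (w.1, w.2, @oone R)
  end.

Fixpoint Ck_on (R : realType) (E F : normedModType R) (k : nat)
    (f : E -> F) (D : set E) : Prop :=
  match k with
  | 0 => {within D, continuous f}
  | k'.+1 => (forall x, D x -> differentiable f x) /\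
             (forall v : E, Ck_on k' (fun x => 'd f x v) D)
  end.

Definition smooth_on (R : realType) (E F : normedModType R) (f : E -> F)
    (D : set E) : Prop := forall k, Ck_on k f D.

Definition second_countable (X : topologicalType) : Prop :=
  exists B : nat -> set X, (forall n, open (B n)) /\
    forall V : set X, open V -> forall x, V x -> exists n, B n x /\ B n `<=` V.

(* X is a smooth manifold modelled on E (here E = O'^2 = R^16), with the
   atlas whose charts are the inverses of the maps psi i : W i -> X. *)
Definition smooth_manifold_with_atlas (R : realType) (X : topologicalType)
    (E : normedModType R) (I : Type) (W : I -> set E) (psi : I -> E -> X) : Prop :=
  [/\ hausdorff_space X, second_countable X,
      (forall y : X, exists i w, W i w /\ psi i w = y),
      (forall i, open (W i) /\
         (forall w w', W i w -> W i w' -> psi i w = psi i w' -> w = w') /\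
         {within W i, continuous (psi i)} /\
         (forall V : set E, open V -> V `<=` W i -> open (psi i @` V)))
    &
      (forall i j, exists g : E -> E,
         let D := [set w | W i w /\ exists w', W j w' /\ psi j w' = psi i w] in
         (forall w, D w -> W j (g w) /\ psi j (g w) = psi i w) /\
         smooth_on g D)].

Definition path_connected (R : realType) (X : topologicalType) : Prop :=
  forall x y : X, exists g : R -> X,
    {within @unit_I R, continuous g} /\ g 0 = x /\ g 1 = y.

Definition simply_connected (R : realType) (X : topologicalType) : Prop :=
  path_connected R X /\
  forall g : R -> X, {within @unit_I R, continuous g} -> g 0 = g 1 ->
    exists H : R * R -> X,
      {within @unit_I R `*` @unit_I R, continuous H} /\
      (forall s, @unit_I R s -> H (s, 0) = g s /\ H (s, 1) = g 0) /\
      (forall t, @unit_I R t -> H (0, t) = g 0 /\ H (1, t) = g 0).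

(* Main.v *)
Require Import Defs.
From mathcomp Require Import all_boot all_order all_algebra.
From mathcomp Require Import all_classical all_reals all_analysis.
From mathcomp Require Import ring lra.
Import numFieldNormedType.Exports.
Set Implicit Arguments.
Unset Strict Implicit.
Unset Printing Implicit Defensive.
Import Order.TTheory GRing.Theory Num.Theory.
Local Open Scope classical_set_scope.
Local Open Scope ring_scope.

(** The norm of the para-octonions is multiplicative and (x y) y^-1 = x, so a
    point t of the i-th slice lies in the j-th chart iff its j-th coordinate
    has positive norm, and its j-th affine coordinates are then those of
    t (t_j)^-1: the transition maps are rational. On the overlap of two charts
    the norms of the two inverted coordinates are mutually inverse, so points
    without a common chart are separated by the conditions "norm < 1".

    For simple connectedness, each chart range is star-shaped about 0, and every
    point x can be tethered to [1,1,1] by a path that stays in every chart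
    containing x. A short piece of a loop lies in one chart; together with the
    tethers of its end points it bounds a square that can be coned off there.
    Gluing these squares gives a free homotopy of the loop to the constant
    [1,1,1], which is then made relative to the base point. *)

(** * Functions of class C^k *)

Section CkClosure.
Variable R : realType.

(** The remainder of [f] at [x] is near 0 also the remainder of [g], so uniqueness of the
    differential applies. *)
Lemma near_eq_diff (E F : normedModType R) (f g : E -> F) (x : E) :
  (\forall y \near x, f y = g y) -> differentiable f x ->
  differentiable g x /\ 'd g x = 'd f x :> (E -> F).
Proof.
move=> fg df.
have H : g \o shift x = cst (g x) + 'd f x +o_ 0 id.
  have := diff_locally df => /eqaddoP fo.
  apply/eqaddoP => e e0; have := fo e e0.
  have : \forall y \near (0 : E), f (y + x) = g (y + x).
    have := (near_shift (0 : E) x (fun y => f y = g y)).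
    by rewrite subr0 => <-.
  move=> A B; near=> y.
  have -> : (g \o shift x - (cst (g x) + 'd f x)) y = (f \o shift x - (cst (f x) + 'd f x)) y.
    rewrite !fctE /=; rewrite -(nbhs_singleton fg).
    by have -> : g (y + x) = f (y + x) by symmetry; near: y.
  by near: y.
have E1 : 'd g x = 'd f x :> (E -> F) by apply: diff_unique H; exact: diff_continuous.
split=> //; apply/diff_locallyP; rewrite E1; split => //.
exact: diff_continuous.
Unshelve. all: by end_near.
Qed.

(** [Ck_on] iterates differentials as functions on all of [E], while formulas for them hold only on
    [D]. Openness of [D] lets such a formula replace the differential at every order; each closure
    property below ends this way. *)
Lemma Ck_on_ext (E F : normedModType R) k (D : set E) (f g : E -> F) :
  open D -> (forall x, D x -> f x = g x) -> Ck_on k f D -> Ck_on k g D.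
Proof.
move=> oD; elim: k f g => [|k IH] f g fg /=.
  by apply: subspace_eq_continuous => x; rewrite inE => /fg.
have nfg x : D x -> \forall y \near x, f y = g y.
  by move=> Dx; apply: filterS (open_nbhs_nbhs (conj oD Dx)).
case=> df Cf; split=> [x Dx|v].
  by have [] := near_eq_diff (nfg x Dx) (df x Dx).
apply: IH (Cf v) => x Dx.
by have [_ ->] := near_eq_diff (nfg x Dx) (df x Dx).
Qed.

Lemma Ck_onW (E F : normedModType R) k (D : set E) (f : E -> F) :
  Ck_on k.+1 f D -> Ck_on k f D.
Proof.
elim: k f => [|k IH] f /= [df Cf].
  apply: continuous_in_subspaceT => x; rewrite inE => Dx.
  exact/differentiable_continuous/df.
by split=> // v; apply: IH; exact: Cf.
Qed.

Section Fixed.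
Variables (E : normedModType R) (D : set E).
Hypothesis oD : open D.

Lemma Ck_on_cst (F : normedModType R) k (c : F) : Ck_on k (fun _ : E => c) D.
Proof.
elim: k c => [|k IH] c /=; first by apply: continuous_subspaceT => x; exact: cvg_cst.
split=> [x _|v]; first exact: differentiable_cst.
by apply: (Ck_on_ext oD _ (IH 0)) => x _; rewrite (diff_cst c x).
Qed.

Lemma Ck_on_id k : Ck_on k (fun x : E => x) D.
Proof.
case: k => [|k] /=; first by apply: continuous_subspaceT => x; exact: cvg_id.
have cid : continuous (idfun : E -> E) by move=> x; exact: cvg_id.
split=> [x _|v]; first exact: (@linear_differentiable _ _ _ idfun x cid).
apply: (Ck_on_ext oD _ (Ck_on_cst k v)) => x _.
by rewrite (@diff_lin _ _ _ idfun x cid).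
Qed.

Lemma Ck_on0P (F : normedModType R) (f : E -> F) :
  Ck_on 0 f D <-> forall x, D x -> {for x, continuous f}.
Proof.
rewrite /= continuous_open_subspace//; split=> H x; last by rewrite inE => /H.
by move=> Dx; apply: H; rewrite inE.
Qed.

Lemma Ck_on_pair (F G : normedModType R) k (f : E -> F) (g : E -> G) :
  Ck_on k f D -> Ck_on k g D -> Ck_on k (fun x => (f x, g x)) D.
Proof.
elim: k f g => [|k IH] f g.
  move=> /Ck_on0P cf /Ck_on0P cg; apply/Ck_on0P => x Dx.
  by apply: cvg_pair; [exact: cf|exact: cg].
case=> df Cf [dg Cg]; split=> [x Dx|v].
  by apply: differentiable_pair; [exact: df|exact: dg].
apply: (Ck_on_ext oD _ (IH _ _ (Cf v) (Cg v))) => x Dx.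
by rewrite diff_pair//; [exact: df|exact: dg].
Qed.

Lemma Ck_on_linear (F G : normedModType R) k (f : E -> F) (L : {linear F -> G}) :
  continuous L -> Ck_on k f D -> Ck_on k (fun x => L (f x)) D.
Proof.
move=> cL; elim: k f => [|k IH] f.
  move=> /Ck_on0P cf; apply/Ck_on0P => x Dx.
  by apply: (@continuous_comp _ _ _ f L); [exact: cf|exact: cL].
case=> df Cf; have dL y := linear_differentiable y cL.
split=> [x Dx|v]; first by apply: (@differentiable_comp _ _ _ _ f L) => //; exact: df.
apply: (Ck_on_ext oD _ (IH _ (Cf v))) => x Dx.
have E1 := @diff_comp _ _ _ _ f L x (df x Dx) (dL (f x)).
by rewrite -[RHS]/('d (L \o f) x v) E1 diff_lin.
Qed.

Lemma Ck_on_fst (F G : normedModType R) k (f : E -> F * G) :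
  Ck_on k f D -> Ck_on k (fun x => (f x).1) D.
Proof.
by apply: (@Ck_on_linear _ _ k f fst) => x; exact: cvg_fst.
Qed.

Lemma Ck_on_snd (F G : normedModType R) k (f : E -> F * G) :
  Ck_on k f D -> Ck_on k (fun x => (f x).2) D.
Proof.
by apply: (@Ck_on_linear _ _ k f snd) => x; exact: cvg_snd.
Qed.

Lemma Ck_on_add (F : normedModType R) k (f g : E -> F) :
  Ck_on k f D -> Ck_on k g D -> Ck_on k (fun x => f x + g x) D.
Proof.
elim: k f g => [|k IH] f g.
  move=> /Ck_on0P cf /Ck_on0P cg; apply/Ck_on0P => x Dx.
  by apply: cvgD; [exact: cf|exact: cg].
case=> df Cf [dg Cg]; split=> [x Dx|v].
  by apply: differentiableD; [exact: df|exact: dg].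
apply: (Ck_on_ext oD _ (IH _ _ (Cf v) (Cg v))) => x Dx.
have := diffD (df x Dx) (dg x Dx).
rewrite (_ : f + g = (fun y => f y + g y)); last by [].
by move/(congr1 (fun h => h v)) => /esym.
Qed.

Lemma Ck_on_opp (F : normedModType R) k (f : E -> F) :
  Ck_on k f D -> Ck_on k (fun x => - f x) D.
Proof.
elim: k f => [|k IH] f.
  by move=> /Ck_on0P cf; apply/Ck_on0P => x Dx; apply: cvgN; exact: cf.
case=> df Cf; split=> [x Dx|v]; first by apply: differentiableN; exact: df.
apply: (Ck_on_ext oD _ (IH _ (Cf v))) => x Dx.
have := diffN (df x Dx).
rewrite (_ : - f = (fun y => - f y)); last by [].
by move/(congr1 (fun h => h v)) => /esym.
Qed.

(** Induction by the Leibniz rule. The factors themselves reappear next to the derivatives, so their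
    regularity is first lowered by [Ck_onW]. *)
Lemma Ck_on_mul k (f g : E -> R) :
  Ck_on k f D -> Ck_on k g D -> Ck_on k (fun x => f x * g x) D.
Proof.
elim: k f g => [|k IH] f g.
  move=> /Ck_on0P cf /Ck_on0P cg; apply/Ck_on0P => x Dx.
  by apply: cvgM; [exact: cf|exact: cg].
move=> Cf1 Cg1; have [df Cf] := Cf1; have [dg Cg] := Cg1; split=> [x Dx|v].
  by apply: differentiableM; [exact: df|exact: dg].
apply: (Ck_on_ext oD _ (Ck_on_add (IH _ _ (Ck_onW Cf1) (Cg v))
  (IH _ _ (Ck_onW Cg1) (Cf v)))) => x Dx.
have := diffM (df x Dx) (dg x Dx).
rewrite (_ : f * g = (fun y => f y * g y)); last by [].
by move/(congr1 (fun h => h v)) => /esym.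
Qed.

Lemma Ck_on_inv k (f : E -> R) : (forall x, D x -> f x != 0) ->
  Ck_on k f D -> Ck_on k (fun x => (f x)^-1) D.
Proof.
move=> f0; elim: k => [|k IH].
  by move=> /Ck_on0P cf; apply/Ck_on0P => x Dx; apply: cvgV; [exact: f0|exact: cf].
move=> Cf1; have [df Cf] := Cf1; split=> [x Dx|v].
  by apply: differentiableV; [exact: df|exact: f0].
have If := IH (Ck_onW Cf1).
apply: (Ck_on_ext oD _ (Ck_on_opp (Ck_on_mul (Ck_on_mul If If) (Cf v)))) => x Dx.
have /(congr1 (fun h => h v)) /esym := diffV (df x Dx) (f0 x Dx).
by apply: etrans; rewrite /= scaleNr -exprVn expr2.
Qed.

End Fixed.
Lemma C0_continuous (E F : normedModType R) (f : E -> F) : Ck_on 0 f setT -> continuous f.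
Proof. by move=> /(Ck_on0P openT) h x; exact: h. Qed.

End CkClosure.

(** * Continuous maps *)

Section Topology.
Variable R : realType.

(** Pasting along the zero set of [h]. Both branches are continuous everywhere, so no relative
    topology enters. *)
Lemma continuous_if (T X : topologicalType) (h : T -> R) (A B : T -> X) :
  continuous h -> continuous A -> continuous B ->
  (forall z, h z = 0 -> A z = B z) ->
  continuous (fun z => if h z <= 0 then A z else B z).
Proof.
move=> ch cA cB AB z U /=.
case: ltrgt0P => [hz|hz|hz] nU.
- have : \forall y \near z, 0 < h y by exact: (cvgr_gt _ (ch z)).
  have : \forall y \near z, U (B y) by exact: cB.
  by apply: filterS2 => y UB hy; rewrite /= leNgt hy.
- have : \forall y \near z, h y < 0 by exact: (cvgr_lt _ (ch z)).
  have : \forall y \near z, U (A y) by exact: cA.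
  by apply: filterS2 => y UB hy; rewrite /= ltW.
- have : \forall y \near z, U (B y) by apply: cB; rewrite -AB.
  have : \forall y \near z, U (A y) by exact: cA.
  by apply: filterS2 => y UA UB /=; case: ifP.
Qed.

Lemma continuous_minr (T : topologicalType) (f g : T -> R) :
  continuous f -> continuous g -> continuous (fun z => Num.min (f z) (g z)).
Proof.
move=> cf cg.
rewrite (_ : (fun z => _) = (fun z => if f z - g z <= 0 then f z else g z)).
  apply: continuous_if => //; last by move=> z /subr0_eq.
  by move=> z; apply: cvgB; [exact: cf|exact: cg].
by apply/funext => z; rewrite subr_le0 minEle.
Qed.

Lemma continuous_maxr (T : topologicalType) (f g : T -> R) :
  continuous f -> continuous g -> continuous (fun z => Num.max (f z) (g z)).
Proof.
move=> cf cg.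
rewrite (_ : (fun z => _) = (fun z => if f z - g z <= 0 then g z else f z)).
  apply: continuous_if => //; last by move=> z /subr0_eq.
  by move=> z; apply: cvgB; [exact: cf|exact: cg].
by apply/funext => z; rewrite subr_le0 maxEle.
Qed.

(** The retraction of the line onto the unit interval. It turns paths on the interval into globally
    continuous maps. *)
Definition clamp (t : R) : R := Num.max 0 (Num.min 1 t).

Lemma continuous_clamp : continuous clamp.
Proof.
apply: continuous_maxr; first by move=> x; exact: cvg_cst.
by apply: continuous_minr => x; [exact: cvg_cst|exact: cvg_id].
Qed.

Lemma clamp_itv t : 0 <= clamp t <= 1.
Proof. by rewrite /clamp le_max lexx /= ge_max ler01 ge_min lexx. Qed.

Lemma clamp_id t : 0 <= t <= 1 -> clamp t = t.
Proof. by move=> /andP[t0 t1]; rewrite /clamp min_r// max_r. Qed.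

Lemma clamp_le0 t : t <= 0 -> clamp t = 0.
Proof. by move=> t0; rewrite /clamp min_r ?max_l//; lra. Qed.

Lemma clamp_ge1 t : 1 <= t -> clamp t = 1.
Proof. by move=> t0; rewrite /clamp min_l ?max_r//; lra. Qed.

Lemma continuous_within_comp (T X Y : topologicalType) (A : set X)
    (f : X -> Y) (h : T -> X) :
  {within A, continuous f} -> continuous h -> (forall t, A (h t)) ->
  continuous (f \o h).
Proof.
move=> /subspace_continuousP cf ch Ah t U /= nU.
have := cf _ (Ah t) _ nU.
move=> H; have N : \forall s \near t, A (h s) -> U (f (h s)) by exact: (ch t _ H).
by apply: filterS N => s; apply; exact: Ah.
Qed.

(** Compactness of the unit interval in the form needed for cutting a loop into short pieces: the
    supremum of the points reachable from 0 is reached and equals 1. *)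
Lemma segment_chain (P : R -> R -> Prop) :
  (forall a b c, a < b -> b < c -> P a b -> P b c -> P a c) ->
  (forall s, exists2 e, 0 < e & forall a b, s - e < a -> a < b -> b < s + e -> P a b) ->
  P 0 1.
Proof.
move=> tr loc.
pose A := [set x : R | 0 < x <= 1 /\ P 0 x].
have A1 : ubound A 1 by move=> x [/andP[]].
have A0 : A !=set0.
  have [e e0 He] := loc 0.
  have y0 : 0 < Num.min 1 (e / 2) by rewrite lt_min; apply/andP; split; lra.
  have y1 : Num.min 1 (e / 2) <= 1 by rewrite ge_min lexx.
  have ye : Num.min 1 (e / 2) <= e / 2 by rewrite ge_min lexx orbT.
  exists (Num.min 1 (e / 2)); split; first exact/andP.
  by apply: He => //; lra.
have sA : has_sup A by split=> //; exists 1.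
have c1 : sup A <= 1 by exact: ge_sup.
have [e e0 He] := loc (sup A).
have [x Ax xe] := sup_adherent e0 sA.
have xc : x <= sup A by apply: sup_upper_bound.
have [/andP[x0 x1] Px] := Ax.
have [|x1'] := leP 1 x; first by move=> ?; have <- : x = 1 by lra.
(* The interval from [x] to [y] lies within [e] of the supremum, so [y] belongs to [A]. As [y]
   cannot exceed [sup A], the cap must be active: [y = 1]. *)
pose y := Num.min 1 (sup A + e / 2).
have xy : x < y by rewrite lt_min; apply/andP; split; lra.
have y1 : y <= 1 by rewrite ge_min lexx.
have ye : y <= sup A + e / 2 by rewrite ge_min lexx orbT.
have Ay : A y.
  split; first by apply/andP; split; lra.
  by apply: (tr 0 x y) => //; apply: He => //; lra.
have yc : y <= sup A by apply: sup_upper_bound.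
have [h|h] := leP 1 (sup A + e / 2); first by case: Ay => _; rewrite /y min_l.
by exfalso; move: yc; rewrite /y min_r; lra.
Qed.

(** Only the apex needs an argument: there the factor [|p|] tends to 0 while the values of [C]
    remain bounded. *)
Lemma cone_continuous (E : normedModType R) (C : R * R -> E) : continuous C ->
  continuous (fun p : R * R => `|p| *: C (`|p|^-1 *: p)).
Proof.
move=> cC p; have [->|p0] := eqVneq p 0; last first.
  have cn : {for p, continuous (fun q : R * R => `|q|)} by exact: norm_continuous.
  apply: cvgZ; first exact: cn.
  apply: (@continuous_comp _ _ _ (fun q : R * R => `|q|^-1 *: q) C); last exact: cC.
  apply: cvgZ; last exact: cvg_id.
  by apply: cvgV; [rewrite normr_eq0|exact: cn].
(* The unit ball of the max norm is a compact square. Since [0^-1 = 0], the argument of [C] has norm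
   1 or 0, hence always lies in it. *)
have [M M0 CM] : exists2 M : R, 0 < M & forall q : R * R, `|q| <= 1 -> `|C q| <= M.
  have cpt : compact (C @` (`[-1, 1]%classic `*` `[-1, 1]%classic)).
    apply: continuous_compact; first exact: continuous_subspaceT.
    by apply: compact_setX; exact: segment_compact.
  have [M M0 HM] := ex_strict_bound_gt0 (compact_bounded cpt).
  exists M => // q; rewrite prod_normE ge_max => /andP[q1 q2].
  apply: ltW; apply: HM; exists q => //.
  by split; rewrite /= in_itv /= -ler_norml.
rewrite /continuous_at normr0 scale0r.
apply/cvgr0Pnorm_le => e e0.
have : \forall q \near (0 : R * R), `|q| <= e / M.
  apply/nbhs_normP; exists (e / M); first by rewrite /= divr_gt0.
  by move=> q /=; rewrite sub0r normrN => /ltW.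
apply: filterS => q qe.
rewrite normrZ normr_id -(divfK (lt0r_neq0 M0) e).
apply: ler_pM => //; apply: CM.
rewrite normrZ normfV normr_id; have [->|q0] := eqVneq `|q| 0; first by rewrite mulr0.
by rewrite mulVf.
Qed.

Lemma open_pos (T : topologicalType) (f : T -> R) : continuous f -> open [set x | 0 < f x].
Proof.
move=> cf; apply: (@open_comp _ _ f [set x | 0 < x]) => [x _|]; first exact: cf.
exact: open_gt.
Qed.

End Topology.

(** * Spaces covered by star-shaped charts *)

Section StarFill.
Variable R : realType.

(* The Coons patch of the four sides may leave [W]; coning off its restriction to
   the boundary of the square does not. *)
Lemma star_square_fill (E : normedModType R) (W : set E) (bot l r : R -> E) (e : E) :
  (forall w (k : R), W w -> 0 <= k <= 1 -> W (k *: w)) ->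
  continuous bot -> continuous l -> continuous r ->
  (forall t, 0 <= t <= 1 -> [/\ W (bot t), W (l t) & W (r t)]) ->
  l 0 = bot 0 -> r 0 = bot 1 -> l 1 = e -> r 1 = e ->
  exists F : R * R -> E, [/\ continuous F,
    (forall s t, 0 <= s <= 1 -> 0 <= t <= 1 -> W (F (s, t))),
    (forall t, 0 <= t <= 1 -> F (0, t) = l t /\ F (1, t) = r t) &
    (forall s, 0 <= s <= 1 -> F (s, 0) = bot s /\ F (s, 1) = e)].
Proof.
move=> star cb cl cr Wblr l0 r0 l1 r1.
(* Linear interpolation from [bot s] to [e], plus a correction for each lateral side. The corner
   conditions make all four sides come out exactly. *)
pose B (s t : R) := (1 - t) *: bot s + t *: e
   + (1 - s) *: (l t - ((1 - t) *: l 0 + t *: e))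
   + s *: (r t - ((1 - t) *: r 0 + t *: e)).
have B0 t : B 0 t = l t.
  by rewrite /B subr0 scale1r scale0r addr0 l0 addrC subrK.
have B1 t : B 1 t = r t.
  by rewrite /B subrr scale0r addr0 scale1r r0 addrC subrK.
have Bs0 s : B s 0 = bot s.
  by rewrite /B subr0 !scale1r !scale0r !addr0 !subrr !scaler0 !addr0.
have Bs1 s : B s 1 = e.
  by rewrite /B subrr !scale1r !scale0r !add0r l1 r1 !subrr !scaler0 !addr0.
(* Rescaling both axes to [[-1, 1]] makes the boundary of the square the unit sphere of the max
   norm. *)
pose C (p : R * R) := B ((p.1 + 1) / 2) ((p.2 + 1) / 2).
pose S := (fun p : R * R => (p.1 + 1) / 2); pose T := (fun p : R * R => (p.2 + 1) / 2).
have cS : continuous S.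
  by move=> p; apply: cvgMl; apply: cvgD; [exact: cvg_fst|exact: cvg_cst].
have cT : continuous T.
  by move=> p; apply: cvgMl; apply: cvgD; [exact: cvg_snd|exact: cvg_cst].
have cst1 (c : R) : continuous (fun _ : R * R => c) by move=> ?; exact: cvg_cst.
have cste (c : E) : continuous (fun _ : R * R => c) by move=> ?; exact: cvg_cst.
have cD (f g : R * R -> E) : continuous f -> continuous g -> continuous (fun p => f p + g p).
  by move=> cf cg p; apply: cvgD; [exact: cf|exact: cg].
have cN (f g : R * R -> E) : continuous f -> continuous g -> continuous (fun p => f p - g p).
  by move=> cf cg p; apply: cvgB; [exact: cf|exact: cg].
have cN1 (f g : R * R -> R) : continuous f -> continuous g -> continuous (fun p => f p - g p).
  by move=> cf cg p; apply: cvgB; [exact: cf|exact: cg].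
have cZ (f : R * R -> R) (g : R * R -> E) :
    continuous f -> continuous g -> continuous (fun p => f p *: g p).
  by move=> cf cg p; apply: cvgZ; [exact: cf|exact: cg].
have cC : continuous C.
  have co f (h : R * R -> R) :
      continuous f -> continuous h -> continuous (fun p => f (h p) : E).
    by move=> cf ch p; apply: continuous_comp; [exact: ch|exact: cf].
  have X f : continuous (fun p => (1 - T p) *: (f : E) + T p *: e).
    by apply: cD; apply: cZ => //; exact: cN1.
  apply: (cD (fun p => _ + _)); first apply: (cD (fun p => _ + _)).
  - by apply: (cD (fun p => (1 - T p) *: bot (S p)) (fun p => T p *: e));
      apply: cZ => //; [exact: cN1|exact: co].
  - apply: (cZ (fun p => 1 - S p) (fun p => l (T p) - _)); first exact: cN1.
    by apply: (cN (fun p => l (T p))); [exact: co|exact: X].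
  - apply: (cZ S (fun p => r (T p) - _)) => //.
    by apply: (cN (fun p => r (T p))); [exact: co|exact: X].
have CW (q : R * R) : `|q| = 1 -> W (C q).
  case: q => u v; rewrite prod_normE /= => m1.
  have /andP[u1 u2] : -1 <= u <= 1 by rewrite -ler_norml -m1 le_max lexx.
  have /andP[v1 v2] : -1 <= v <= 1 by rewrite -ler_norml -m1 le_max lexx orbT.
  have [W1 W2 W3] := Wblr ((u + 1) / 2) ltac:(apply/andP; split; lra).
  have [W4 W5 W6] := Wblr ((v + 1) / 2) ltac:(apply/andP; split; lra).
  have We : W e by rewrite -l1; have [] := Wblr 1 ltac:(apply/andP; split; lra).
  rewrite /C /=; have /orP[/eqP|/eqP] : (`|u| == 1) || (`|v| == 1).
    by move: m1; rewrite maxEle; case: ifP => _ ->; rewrite eqxx ?orbT.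
  - by case: ler0P => _ hu; [have -> : (u + 1) / 2 = 0 by lra|
      have -> : (u + 1) / 2 = 1 by lra];
      rewrite ?B0 ?B1.
  - by case: ler0P => _ hu; [have -> : (v + 1) / 2 = 0 by lra|
      have -> : (v + 1) / 2 = 1 by lra];
      rewrite ?Bs0 ?Bs1.
(* The cone with apex 0: inside the square [G p] is a value of [C] on the boundary scaled by
   [|p| <= 1], so star-shapedness keeps it in [W]. *)
pose G (p : R * R) := `|p| *: C (`|p|^-1 *: p).
have G1 p : `|p| = 1 -> G p = C p by rewrite /G => ->; rewrite invr1 !scale1r.
have n1 (u v : R) : `|u| = 1 -> -1 <= v <= 1 -> `|(u, v)| = 1 :> R.
  by move=> u1 v1; rewrite prod_normE /= u1 max_l// ler_norml.
have n2 (u v : R) : `|v| = 1 -> -1 <= u <= 1 -> `|(u, v)| = 1 :> R.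
  by move=> u1 v1; rewrite prod_normE /= u1 max_r// ler_norml.
have N0 : `|2 * 0 - 1| = 1 :> R by rewrite mulr0 add0r normrN normr1.
have N1 : `|2 * 1 - 1| = 1 :> R.
  by rewrite (_ : 2 * 1 - 1 = 1 :> R) ?normr1//; lra.
exists (fun p => G (2 * p.1 - 1, 2 * p.2 - 1)); split.
- move=> p.
  apply: (@continuous_comp _ _ _ (fun p : R * R => (2 * p.1 - 1, 2 * p.2 - 1)) G);
    last exact: cone_continuous.
  have c1 : continuous (fun p : R * R => 2 * p.1 - 1).
    by move=> q; apply: cvgB; [apply: cvgMr; exact: cvg_fst|exact: cvg_cst].
  have c2 : continuous (fun p : R * R => 2 * p.2 - 1).
    by move=> q; apply: cvgB; [apply: cvgMr; exact: cvg_snd|exact: cvg_cst].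
  exact: (cvg_pair (c1 p) (c2 p)).
- move=> s t /andP[s0 s1] /andP[t0 t1]; rewrite /=.
  set p := (_, _).
  have p1 : `|p| <= 1.
    by rewrite prod_normE /= ge_max !ler_norml; apply/andP; split; apply/andP; split; lra.
  have [p0|p0] := eqVneq p 0.
    rewrite /G p0 normr0 scale0r -(scale0r (bot 0)); apply: star; last by rewrite lexx ler01.
    by have [] := Wblr 0 ltac:(apply/andP; split; lra).
  apply: star; last by rewrite normr_ge0.
  by apply: CW; rewrite normrZ normfV normr_id mulVf// normr_eq0.
- move=> t /andP[t0 t1] /=; rewrite !G1 /C /=.
  + have -> : (2 * 0 - 1 + 1) / 2 = 0 :> R by lra.
    have -> : (2 * 1 - 1 + 1) / 2 = 1 :> R by lra.
    have -> : (2 * t - 1 + 1) / 2 = t :> R by lra.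
    by rewrite B0 B1.
  + by apply: n1; [rewrite ?N0 ?N1|apply/andP; split; lra].
  + by apply: n1; [rewrite ?N0 ?N1|apply/andP; split; lra].
- move=> s /andP[s0 s1] /=; rewrite !G1 /C /=.
  + have -> : (2 * 0 - 1 + 1) / 2 = 0 :> R by lra.
    have -> : (2 * 1 - 1 + 1) / 2 = 1 :> R by lra.
    have -> : (2 * s - 1 + 1) / 2 = s :> R by lra.
    by rewrite Bs0 Bs1.
  + by apply: n2; [rewrite ?N0 ?N1|apply/andP; split; lra].
  + by apply: n2; [rewrite ?N0 ?N1|apply/andP; split; lra].
Qed.

End StarFill.

Section StarCharts.
Variables (R : realType) (X : topologicalType) (E : normedModType R) (I : Type).
Variables (W : set E) (psi : I -> E -> X).
Hypothesis star : forall w (k : R), W w -> 0 <= k <= 1 -> W (k *: w).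
Hypothesis psi_inj : forall i w w', W w -> W w' -> psi i w = psi i w' -> w = w'.
Hypothesis psi_cts : forall i, {within W, continuous (psi i)}.
Hypothesis psi_open : forall i (V : set E), open V -> V `<=` W -> open (psi i @` V).
Hypothesis oW : open W.

Let U i : set X := psi i @` W.

(** Preimages under [psi i] are unique in [W], so any choice of them is continuous by openness of
    [psi i]. *)
Lemma chart_lift (T : topologicalType) i (h : T -> X) :
  continuous h -> (forall t, U i (h t)) ->
  exists hl : T -> E, [/\ continuous hl, forall t, W (hl t) & forall t, psi i (hl t) = h t].
Proof.
move=> ch Uh.
have /choice[hl hlP] : forall t, exists w, W w /\ psi i w = h t.
  by move=> t; have [w Ww <-] := Uh t; exists w.
exists hl; split; [|by move=> t; case: (hlP t)|by move=> t; case: (hlP t)].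
move=> t V; rewrite /= nbhsE /= => -[Q [oQ Qt] QV].
have oQW : open (Q `&` W) by exact: openI.
have nP : nbhs (h t) (psi i @` (Q `&` W)).
  apply: open_nbhs_nbhs; split; first by apply: psi_open => // w [].
  by have [? <-] := hlP t; exists (hl t).
have N : \forall s \near t, (psi i @` (Q `&` W)) (h s) by exact: (ch t _ nP).
apply: filterS N => s [w [Qw Ww] e].
have [Ws es] := hlP s; suff E1 : hl s = w by apply: QV; rewrite E1.
by apply: (@psi_inj i) => //; rewrite es e.
Qed.

Variable x0 : X.
Hypothesis cover : forall x, exists i, U i x.
Hypothesis tether : forall x, exists c : R -> X, [/\ continuous c,
  forall t, t <= 0 -> c t = x, forall t, 1 <= t -> c t = x0 &
  forall i, U i x -> forall t, U i (c t)].

Section Loop.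
Variable c : X -> R -> X.
Hypothesis cP : forall x, [/\ continuous (c x),
  forall t, t <= 0 -> c x t = x, forall t, 1 <= t -> c x t = x0 &
  forall i, U i x -> forall t, U i (c x t)].
Variable g : R -> X.
Hypothesis cg : continuous g.

(** The lateral sides are prescribed for every real [t], not only on the unit interval, so that
    adjacent squares can be pasted by [continuous_if]. *)
Let fill (a b : R) := exists K : R * R -> X, [/\ continuous K,
  (forall t, K (a, t) = c (g a) t), (forall t, K (b, t) = c (g b) t) &
  (forall s, a <= s <= b -> K (s, 0) = g s /\ K (s, 1) = x0)].

Lemma clamp_tether x t : c x (clamp t) = c x t.
Proof.
have [_ h0 h1 _] := cP x.
have [t0|t0] := leP t 0; first by rewrite clamp_le0// !h0.
have [t1|t1] := leP 1 t; first by rewrite clamp_ge1// !h1.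
by rewrite clamp_id// !ltW.
Qed.

Lemma fill_trans a b d : a < b -> b < d -> fill a b -> fill b d -> fill a d.
Proof.
move=> ab bd [K [cK Ka Kb Ks]] [L [cL La Lb Ls]].
exists (fun p => if p.1 - b <= 0 then K p else L p); split.
- apply: continuous_if => //.
    by move=> p; apply: cvgB; [exact: cvg_fst|exact: cvg_cst].
  by case=> s t /= /subr0_eq ->; rewrite Kb La.
- by move=> t /=; rewrite subr_le0 ltW.
- by move=> t /=; rewrite subr_le0 leNgt bd /= Lb.
- move=> s /andP[s0 s1] /=; rewrite subr_le0.
  by case: (leP s b) => h; [apply: Ks; rewrite s0 h|apply: Ls; rewrite s1 (ltW h)].
Qed.

(** The piece of the loop and both tethers lift to [W], where [star_square_fill] applies.
    Injectivity of [psi i] matches the lifted corners; in particular both tethers end at the same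
    lift of [x0]. *)
Lemma fill_chart i a b : a < b -> (forall s, a <= s <= b -> U i (g s)) -> fill a b.
Proof.
move=> ab Ug.
(* [A] never leaves [[a, b]], so the piece of the loop can be lifted over the whole line. *)
pose A (s : R) := a + (b - a) * clamp s.
have Aab s : a <= A s <= b.
  by rewrite /A; have /andP[k0 k1] := clamp_itv s; apply/andP; split; nra.
have cA : continuous A.
  move=> s; apply: cvgD; first exact: cvg_cst.
  by apply: cvgMr; exact: continuous_clamp.
have cgA : continuous (g \o A).
  by move=> s; apply: continuous_comp; [exact: cA|exact: cg].
have [bot [cb Wb pb]] := chart_lift cgA (fun s => Ug _ (Aab s)).
have [ca ca0 ca1 caU] := cP (g a).
have [ce ce0 ce1 ceU] := cP (g b).
have [l [cl Wl pl]] := chart_lift ca (caU i (Ug a ltac:(by rewrite lexx ltW))).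
have [r [cr Wr pr]] := chart_lift ce (ceU i (Ug b ltac:(by rewrite lexx ltW))).
have A0 : A 0 = a by rewrite /A clamp_le0// mulr0 addr0.
have A1 : A 1 = b by rewrite /A clamp_ge1// mulr1 addrC subrK.
have [||||F [cF WF Flr Fbt]] := @star_square_fill R E W bot l r (l 1)
  star cb cl cr (fun t _ => And3 (Wb t) (Wl t) (Wr t)).
- by apply: (@psi_inj i) => //; rewrite pl pb /= A0 ca0.
- by apply: (@psi_inj i) => //; rewrite pr pb /= A1 ce0.
- by [].
- by apply: (@psi_inj i) => //; rewrite pl pr ca1// ce1.
pose S (p : R * R) := (clamp ((p.1 - a) / (b - a)), clamp p.2).
have cS : continuous S.
  have c1 : continuous (fun p : R * R => clamp ((p.1 - a) / (b - a))).
    move=> p; apply: (@continuous_comp _ R R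
      (fun p : R * R => (p.1 - a) / (b - a)) (@clamp R)); last exact: continuous_clamp.
    by apply: cvgMl; apply: cvgB; [exact: cvg_fst|exact: cvg_cst].
  have c2 : continuous (fun p : R * R => clamp p.2).
    by move=> p; apply: (@continuous_comp _ R R snd (@clamp R));
      [exact: cvg_snd|exact: continuous_clamp].
  by move=> p; exact: (cvg_pair (c1 p) (c2 p)).
have cFS : continuous (F \o S).
  by move=> p; apply: continuous_comp; [exact: cS|exact: cF].
have ba : b - a != 0 by rewrite subr_eq0 gt_eqF.
exists (psi i \o (F \o S)); split.
- apply: (continuous_within_comp (@psi_cts i) cFS) => p /=.
  by apply: WF; exact: clamp_itv.
- move=> t; rewrite /= /S /= subrr mul0r clamp_le0//.
  by have [-> _] := Flr _ (clamp_itv t); rewrite pl clamp_tether.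
- move=> t; rewrite /= /S /= divff// clamp_ge1//.
  by have [_ ->] := Flr _ (clamp_itv t); rewrite pr clamp_tether.
- move=> s /andP[s0 s1]; rewrite /= /S /= (clamp_le0 (lexx 0)) (clamp_ge1 (lexx 1)).
  set u := clamp _; have [-> ->] := Fbt u (clamp_itv _).
  rewrite pb pl ca1//; split=> //=; congr g.
  have u01 : 0 <= (s - a) / (b - a) <= 1.
    apply/andP; split; first by rewrite divr_ge0 ?subr_ge0 ?(ltW ab).
    by rewrite ler_pdivrMr ?subr_gt0// mul1r lerB.
  rewrite /A /u (clamp_id u01) (clamp_id u01).
  by rewrite mulrC divfK// addrC subrK.
Qed.

Lemma fill01 : fill 0 1.
Proof.
apply: segment_chain => [a b d|s]; first exact: fill_trans.
have [i Ui] := cover (g s).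
have nU : nbhs (g s) (U i).
  by apply: open_nbhs_nbhs; split=> //; exact: psi_open.
have /nbhs_normP[e e0 He] : nbhs s (g @^-1` (U i)) by exact: cg nU.
exists e => // a b sa ab bs; apply: (@fill_chart i) => // u /andP[u0 u1].
by apply: He; rewrite /= ltr_distlC; apply/andP; split; lra.
Qed.

Lemma loop_contracts : g 0 = g 1 -> exists H : R * R -> X, [/\ continuous H,
    (forall s, 0 <= s <= 1 -> H (s, 0) = g s /\ H (s, 1) = g 0) &
    (forall t, 0 <= t <= 1 -> H (0, t) = g 0 /\ H (1, t) = g 0)].
Proof.
move=> g01; have [K [cK K0 K1 Ks]] := fill01.
have [cc c0 c1 _] := cP (g 0).
(* Widening [K] by its lateral sides, run from and back to [g 0], keeps the end
   points of the loop fixed; for [t >= 1/2] the tether of [g 0] that remains is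
   retracted. *)
pose tau (p : R * R) := Num.min (2 * p.2) (2 - 2 * p.2).
pose x (p : R * R) := p.1 + tau p * (2 * p.1 - 1).
(* [x] stretches the unit interval onto [[- tau, 1 + tau]]. The height [th] is [tau] over [[0, 1]]
   and falls linearly to 0 at both ends, where the clamp in [A] leaves only a lateral side. *)
pose th (p : R * R) := Num.min (tau p) (Num.min (tau p + x p) (tau p + 1 - x p)).
have ck (k : R) : continuous (fun _ : R * R => k) by move=> p; exact: cvg_cst.
have cD (f h : R * R -> R) : continuous f -> continuous h -> continuous (fun p => f p + h p).
  by move=> cf ch p; apply: cvgD; [exact: cf|exact: ch].
have cB (f h : R * R -> R) : continuous f -> continuous h -> continuous (fun p => f p - h p).
  by move=> cf ch p; apply: cvgB; [exact: cf|exact: ch].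
have cM (f h : R * R -> R) : continuous f -> continuous h -> continuous (fun p => f p * h p).
  by move=> cf ch p; apply: cvgM; [exact: cf|exact: ch].
have cp1 : continuous (fun p : R * R => p.1) by move=> p; exact: cvg_fst.
have cp2 : continuous (fun p : R * R => p.2) by move=> p; exact: cvg_snd.
have ct : continuous tau.
  by apply: continuous_minr; [exact: cM|apply: cB => //; exact: cM].
have cx : continuous x.
  by apply: (cD fst) => //; apply: (cM tau) => //; apply: cB => //; exact: cM.
have cth : continuous th.
  by do 2 apply: continuous_minr => //;
    [exact: (cD tau)|apply: (cB (fun p => tau p + 1)) => //; exact: (cD tau)].
pose A (p : R * R) := K (clamp (x p), th p).
pose B (p : R * R) := c (g 0) (th p).
have cA : continuous A.
  move=> p; apply: (@continuous_comp _ _ _ (fun p => (clamp (x p), th p)) K); last exact: cK.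
  have cX : continuous (@clamp R \o x).
    by move=> q; apply: continuous_comp; [exact: cx|exact: continuous_clamp].
  exact: (cvg_pair (cX p) (cth p)).
have cBB : continuous B.
  by move=> p; apply: continuous_comp; [exact: cth|exact: cc].
have K00 : K (0, 0) = g 0 by rewrite K0 c0.
have K10 : K (1, 0) = g 0 by rewrite K1 -g01 c0.
exists (fun p => if 2 * p.2 - 1 <= 0 then A p else B p); split.
- apply: continuous_if => //; first by apply: cB => //; exact: cM.
  (* On the seam [tau] is 1. Where [x] leaves the open unit interval, [A] already is a value of the
     tether of [g 0]; elsewhere both formulas give [x0]. *)
  move=> p p2; rewrite /A /B.
  have t1 : tau p = 1 by rewrite /tau min_l; lra.
  have [x0'|x0'] := leP (x p) 0; first by rewrite clamp_le0// K0.
  have [x1'|x1'] := leP 1 (x p); first by rewrite clamp_ge1// K1 g01.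
  have -> : th p = 1.
    by rewrite /th t1 min_l// le_min; apply/andP; split; lra.
  rewrite c1// clamp_id ?ltW//.
  by have [] := Ks (x p) ltac:(by rewrite !ltW).
- move=> s /andP[s0 s1] /=.
  have T0 : tau (s, 0) = 0 by rewrite /tau /= min_l; lra.
  have T1 : tau (s, 1) = 0 by rewrite /tau /= min_r; lra.
  have X0 : x (s, 0) = s by rewrite /x T0 mul0r addr0.
  have X1 : x (s, 1) = s by rewrite /x T1 mul0r addr0.
  have th0 : th (s, 0) = 0.
    by rewrite /th T0 X0 min_l// le_min; apply/andP; split; lra.
  have th1 : th (s, 1) = 0.
    by rewrite /th T1 X1 min_l// le_min; apply/andP; split; lra.
  split.
  + rewrite ifT; last by lra.
    by rewrite /A X0 th0 clamp_id ?s0//; have [] := Ks s ltac:(by rewrite s0).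
  + by rewrite ifF; [rewrite /B th1 c0|apply/negbTE; rewrite -ltNge; lra].
- move=> t /andP[t0 t1] /=.
  have tau0 a : 0 <= tau (a, t) by rewrite /tau le_min /=; apply/andP; split; lra.
  have X0 : x (0, t) = - tau (0, t) by rewrite /x /=; ring.
  have X1 : x (1, t) = 1 + tau (1, t) by rewrite /x /=; ring.
  have th0 : th (0, t) = 0.
    have := tau0 0; rewrite /th X0; set u := tau _ => u0.
    by rewrite (min_l (x := u + - u)) ?min_r; lra.
  have th1 : th (1, t) = 0.
    have := tau0 1; rewrite /th X1; set u := tau _ => u0.
    by rewrite (min_r (x := u + (1 + u))) ?min_r; lra.
  split.
  + rewrite /A /B th0 c0// clamp_le0; last by rewrite X0 oppr_le0.
    by case: ifP.
  + rewrite /A /B th1 c0// clamp_ge1; last by rewrite X1 lerDl.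
    by case: ifP.
Qed.

End Loop.

Lemma star_charts_simply_connected : simply_connected R X.
Proof.
have /choice[c cP] := tether; split.
- move=> x y.
  have [cx x0' x1 _] := cP x; have [cy y0 y1 _] := cP y.
  (* The tether of [x] followed by that of [y] backwards. *)
  exists (fun t => if t - 1 / 2 <= 0 then c x (2 * t) else c y (2 - 2 * t)); split; last first.
    split; first by rewrite ifT ?x0'//; lra.
    by rewrite ifF ?y0//; lra.
  apply: continuous_subspaceT; apply: continuous_if.
  + by move=> t; apply: cvgB; [exact: cvg_id|exact: cvg_cst].
  + move=> t; apply: (@continuous_comp _ _ _ (fun t : R => 2 * t) (c x)); last exact: cx.
    by apply: cvgMr; exact: cvg_id.
  + move=> t; apply: (@continuous_comp _ _ _ (fun t : R => 2 - 2 * t) (c y)); last exact: cy.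
    by apply: cvgB; [exact: cvg_cst|apply: cvgMr; exact: cvg_id].
  + by move=> t t2; rewrite x1 ?y1//; lra.
- move=> g wg g01.
  have cg : continuous (g \o @clamp R).
    apply: (continuous_within_comp wg); first exact: continuous_clamp.
    by move=> t; rewrite /unit_I /= in_itv /=; exact: clamp_itv.
  have g0 : (g \o @clamp R) 0 = g 0 by rewrite /= clamp_le0.
  have g1 : (g \o @clamp R) 1 = g 1 by rewrite /= clamp_ge1.
  have [|H [cH Hs Ht]] := loop_contracts cP cg; first by rewrite g0 g1.
  exists H; split; first exact: continuous_subspaceT.
  rewrite /unit_I; split=> [s|t]; rewrite /= in_itv /= => h.
    by have [-> ->] := Hs s h; rewrite g0 /= clamp_id.
  by have [-> ->] := Ht t h; rewrite g0.
Qed.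

End StarCharts.

(** * Para-octonions and homogeneous coordinates *)

Section Algebra.
Variable R : realType.
Implicit Types x y z : poct R.

(** The conjugate of [y] divided by its norm; an inverse as soon as the norm is nonzero. *)
Definition oinv y : poct R :=
  let '((a, b, c, d), (e, f, g, h)) := y in let n := (onorm2 y)^-1 in
  ((n * a, - (n * b), - (n * c), - (n * d)), (- (n * e), - (n * f), - (n * g), - (n * h))).

Lemma onorm2E (a b c d e f g h : R) : onorm2 ((a, b, c, d), (e, f, g, h)) =
  a ^+ 2 + b ^+ 2 + c ^+ 2 + d ^+ 2 - e ^+ 2 - f ^+ 2 - g ^+ 2 - h ^+ 2.
Proof. by rewrite /onorm2 /oinner /ore /=; ring. Qed.

(** The eight-square identity in split signature. *)
Lemma onorm2M x y : onorm2 (omul x y) = onorm2 x * onorm2 y.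
Proof.
move: x y => [[[[x0 x1] x2] x3] [[[x4 x5] x6] x7]] [[[[y0 y1] y2] y3] [[[y4 y5] y6] y7]].
rewrite /omul /qmul /qconj /qadd !onorm2E; ring.
Qed.

Lemma onorm2_one : onorm2 (oone R) = 1.
Proof. by rewrite onorm2E; ring. Qed.

Lemma omul1o y : omul (oone R) y = y.
Proof.
move: y => [[[[y0 y1] y2] y3] [[[y4 y5] y6] y7]].
by rewrite /oone /omul /qmul /qconj /qadd /=; congr (_, _, _, _, (_, _, _, _)); ring.
Qed.

(** The product is not associative, but alternativity gives [(x y) conj(y) = |y|^2 x]. *)
Lemma omulK x y : onorm2 y != 0 -> omul (omul x y) (oinv y) = x.
Proof.
move: x y => [[[[x0 x1] x2] x3] [[[x4 x5] x6] x7]] [[[[y0 y1] y2] y3] [[[y4 y5] y6] y7]].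
rewrite /oinv; set n := onorm2 _ => n0.
(* [E] writes 1 as [m] times the expanded norm; inserted on the right, it makes every component a
   polynomial identity. *)
have := mulVf n0; set m := n^-1; rewrite /n onorm2E => E.
rewrite /omul /qmul /qconj /qadd.
congr (_, _, _, _, (_, _, _, _)); rewrite -[RHS]mul1r -E; ring.
Qed.

Lemma omulVK x y : onorm2 y != 0 -> omul (omul x (oinv y)) y = x.
Proof.
move: x y => [[[[x0 x1] x2] x3] [[[x4 x5] x6] x7]] [[[[y0 y1] y2] y3] [[[y4 y5] y6] y7]].
rewrite /oinv; set n := onorm2 _ => n0.
have := mulVf n0; set m := n^-1; rewrite /n onorm2E => E.
rewrite /omul /qmul /qconj /qadd.
congr (_, _, _, _, (_, _, _, _)); rewrite -[RHS]mul1r -E; ring.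
Qed.

Lemma omulV y : onorm2 y != 0 -> omul y (oinv y) = oone R.
Proof. by move=> y0; rewrite -{1}[y]omul1o omulK. Qed.

End Algebra.

(** * Smoothness of the para-octonion operations *)

Ltac Ck_tac := repeat first [assumption | apply: Ck_on_pair => // |
  apply: Ck_on_add => // | apply: Ck_on_opp => // | apply: Ck_on_mul => // |
  apply: Ck_on_fst => // | apply: Ck_on_snd => // |
  apply: Ck_on_cst => //].

Section CkOctonions.
Variables (R : realType) (E : normedModType R) (D : set E).
Hypothesis oD : open D.

(** The operations destructure their arguments; rewriting them by projections, here and below, makes
    the closure properties applicable. *)
Lemma Ck_on_qadd k (f g : E -> quat R) :
  Ck_on k f D -> Ck_on k g D -> Ck_on k (fun x => qadd (f x) (g x)) D.
Proof.
move=> cf cg; apply: (@Ck_on_ext _ _ _ k D (fun x =>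
 ((f x).1.1.1 + (g x).1.1.1, (f x).1.1.2 + (g x).1.1.2, (f x).1.2 + (g x).1.2,
  (f x).2 + (g x).2))) => //.
  by move=> x _; move: (f x) (g x) => [[[? ?] ?] ?] [[[? ?] ?] ?].
by Ck_tac.
Qed.

Lemma Ck_on_qopp k (f : E -> quat R) :
  Ck_on k f D -> Ck_on k (fun x => qopp (f x)) D.
Proof.
move=> cf; apply: (@Ck_on_ext _ _ _ k D (fun x =>
 (- (f x).1.1.1, - (f x).1.1.2, - (f x).1.2, - (f x).2))) => //.
  by move=> x _; move: (f x) => [[[? ?] ?] ?].
by Ck_tac.
Qed.

Lemma Ck_on_qconj k (f : E -> quat R) :
  Ck_on k f D -> Ck_on k (fun x => qconj (f x)) D.
Proof.
move=> cf; apply: (@Ck_on_ext _ _ _ k D (fun x =>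
 ((f x).1.1.1, - (f x).1.1.2, - (f x).1.2, - (f x).2))) => //.
  by move=> x _; move: (f x) => [[[? ?] ?] ?].
by Ck_tac.
Qed.

Lemma Ck_on_qmul k (f g : E -> quat R) :
  Ck_on k f D -> Ck_on k g D -> Ck_on k (fun x => qmul (f x) (g x)) D.
Proof.
move=> cf cg; apply: (@Ck_on_ext _ _ _ k D (fun x =>
  ((f x).1.1.1 * (g x).1.1.1 - (f x).1.1.2 * (g x).1.1.2 - (f x).1.2 * (g x).1.2 - (f x).2 * (g x).2,
   (f x).1.1.1 * (g x).1.1.2 + (f x).1.1.2 * (g x).1.1.1 + (f x).1.2 * (g x).2 - (f x).2 * (g x).1.2,
   (f x).1.1.1 * (g x).1.2 - (f x).1.1.2 * (g x).2 + (f x).1.2 * (g x).1.1.1 + (f x).2 * (g x).1.1.2,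
   (f x).1.1.1 * (g x).2 + (f x).1.1.2 * (g x).1.2 - (f x).1.2 * (g x).1.1.2 + (f x).2 * (g x).1.1.1))) => //.
  by move=> x _; move: (f x) (g x) => [[[? ?] ?] ?] [[[? ?] ?] ?].
by Ck_tac.
Qed.

Lemma Ck_on_omul k (f g : E -> poct R) :
  Ck_on k f D -> Ck_on k g D -> Ck_on k (fun x => omul (f x) (g x)) D.
Proof.
move=> cf cg; apply: (@Ck_on_ext _ _ _ k D (fun x =>
  (qadd (qmul (f x).1 (g x).1) (qmul (qconj (g x).2) (f x).2),
   qadd (qmul (g x).2 (f x).1) (qmul (f x).2 (qconj (g x).1))))) => //.
  by move=> x _; move: (f x) (g x) => [? ?] [? ?].
by apply: Ck_on_pair => //; apply: Ck_on_qadd; apply: Ck_on_qmul;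
  try apply: Ck_on_qconj; Ck_tac.
Qed.

Lemma Ck_on_oconj k (f : E -> poct R) :
  Ck_on k f D -> Ck_on k (fun x => oconj (f x)) D.
Proof.
move=> cf; apply: (@Ck_on_ext _ _ _ k D (fun x => (qconj (f x).1, qopp (f x).2))) => //.
  by move=> x _; move: (f x) => [? ?].
by apply: Ck_on_pair => //; [apply: Ck_on_qconj|apply: Ck_on_qopp]; Ck_tac.
Qed.

Lemma Ck_on_onorm2 k (f : E -> poct R) :
  Ck_on k f D -> Ck_on k (fun x => onorm2 (f x)) D.
Proof.
move=> cf; apply: (@Ck_on_ext _ _ _ k D (fun x => (omul (f x) (oconj (f x))).1.1.1.1)) => //.
  by move=> x _; rewrite /onorm2 /oinner /ore; case: (omul _ _) => [[[[? ?] ?] ?] ?].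
by do 4 apply: Ck_on_fst => //; apply: Ck_on_omul => //; exact: Ck_on_oconj.
Qed.

Lemma Ck_on_oinv k (f : E -> poct R) : (forall x, D x -> onorm2 (f x) != 0) ->
  Ck_on k f D -> Ck_on k (fun x => oinv (f x)) D.
Proof.
move=> f0 cf; apply: (@Ck_on_ext _ _ _ k D (fun x => let n := (onorm2 (f x))^-1 in
  ((n * (f x).1.1.1.1, - (n * (f x).1.1.1.2), - (n * (f x).1.1.2), - (n * (f x).1.2)),
   (- (n * (f x).2.1.1.1), - (n * (f x).2.1.1.2), - (n * (f x).2.1.2), - (n * (f x).2.2))))) => //.
  by move=> x _; move: (f x) => [[[[? ?] ?] ?] [[[? ?] ?] ?]].
have cn := Ck_on_inv oD f0 (Ck_on_onorm2 cf).
by rewrite /=; Ck_tac.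
Qed.

End CkOctonions.

Section HomogeneousCoordinates.
Variable R : realType.
Implicit Types (i j : chart_index) (t : otriple R) (w : poct R * poct R).

Definition emb i w : otriple R :=
  match i with
  | chart1 => (oone R, w.1, w.2)
  | chart2 => (w.1, oone R, w.2)
  | chart3 => (w.1, w.2, oone R)
  end.

Definition coord i t : poct R :=
  match i with chart1 => t.1.1 | chart2 => t.1.2 | chart3 => t.2 end.

Definition rest i t : poct R * poct R :=
  match i with
  | chart1 => (t.1.2, t.2) | chart2 => (t.1.1, t.2) | chart3 => (t.1.1, t.1.2)
  end.

Definition tmul t (l : poct R) : otriple R := (omul t.1.1 l, omul t.1.2 l, omul t.2 l).

(** Since 1 has norm 1, the inequalities of the three slices all read [0 < tnorm t]. Right
    multiplication by [l] scales [tnorm] by [onorm2 l], so this sign is invariant under the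
    equivalence. *)
Definition tnorm t : R := onorm2 t.1.1 + onorm2 t.1.2 + onorm2 t.2.

Definition dehom j t := rest j (tmul t (oinv (coord j t))).

Lemma proj_equivP s t : proj_equiv s t <-> exists2 l, Opos l & s = tmul t l.
Proof.
split=> [[l [l0 [e1 [e2 e3]]]]|[l l0 ->]]; exists l => //.
by case: s e1 e2 e3 => [[a b] c] /= -> -> ->.
Qed.

Lemma rest_emb i w : rest i (emb i w) = w.
Proof. by case: i w => [] []. Qed.

Lemma coord_emb i w : coord i (emb i w) = oone R.
Proof. by case: i. Qed.

Lemma emb_rest i t : coord i t = oone R -> emb i (rest i t) = t.
Proof. by case: i t => [] [[a b] c] /= ->. Qed.

Lemma coord_tmul i t l : coord i (tmul t l) = omul (coord i t) l.
Proof. by case: i. Qed.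

Lemma tnorm_tmul t l : tnorm (tmul t l) = tnorm t * onorm2 l.
Proof. by rewrite /tnorm !onorm2M !mulrDl. Qed.

Lemma tmulK t l : onorm2 l != 0 -> tmul (tmul t l) (oinv l) = t.
Proof. by case: t => [[a b] c] l0; rewrite /tmul /= !omulK. Qed.

Lemma tmulVK t l : onorm2 l != 0 -> tmul (tmul t (oinv l)) l = t.
Proof. by case: t => [[a b] c] l0; rewrite /tmul /= !omulVK. Qed.

Lemma chart_range_emb i w : chart_range w <-> 0 < tnorm (emb i w).
Proof.
rewrite /chart_range /tnorm; case: i => /=; rewrite onorm2_one //; split; lra.
Qed.

Lemma UcalP t : Ucal t <-> 0 < tnorm t /\ exists i, coord i t = oone R.
Proof.
rewrite /Ucal /U1 /U2 /U3 /tnorm /setU /=; split.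
  by move=> [[|]|] [e h]; (split; first by rewrite e onorm2_one; lra);
    [exists chart1|exists chart2|exists chart3].
by move=> [h [[] /= e]]; rewrite e onorm2_one in h; [left; left|left; right|right];
  split=> //; lra.
Qed.

Lemma Ucal_emb i w : chart_range w -> Ucal (emb i w).
Proof.
move=> /(chart_range_emb i) h; apply/UcalP; split=> //.
by exists i; rewrite coord_emb.
Qed.

Lemma emb_dehom j t : 0 < onorm2 (coord j t) ->
  emb j (dehom j t) = tmul t (oinv (coord j t)).
Proof.
by move=> l0; rewrite emb_rest// coord_tmul omulV// gt_eqF.
Qed.

Lemma onorm2V (l : poct R) : 0 < onorm2 l -> 0 < onorm2 (oinv l).
Proof.
move=> l0; rewrite -(pmulr_rgt0 _ l0) -onorm2M omulV ?onorm2_one//.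
by rewrite gt_eqF.
Qed.

Lemma chart_range_dehom j t : 0 < tnorm t -> 0 < onorm2 (coord j t) ->
  chart_range (dehom j t).
Proof.
move=> t0 l0; apply/(chart_range_emb j).
by rewrite emb_dehom// tnorm_tmul mulr_gt0// onorm2V.
Qed.

(** The j-th coordinate of [emb j w] is 1, so the factor [l] must be the j-th coordinate of [t];
    right cancellation then recovers [w]. *)
Lemma proj_equiv_emb j t w :
  proj_equiv t (emb j w) <-> 0 < onorm2 (coord j t) /\ w = dehom j t.
Proof.
split=> [/proj_equivP[l l0 e]|[l0 ->]]; last first.
  apply/proj_equivP; exists (coord j t) => //.
  by rewrite emb_dehom// tmulVK// gt_eqF.
have el : coord j t = l by rewrite e coord_tmul coord_emb omul1o.
rewrite /dehom el; split=> //.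
have {1}-> := e; rewrite tmulK ?rest_emb//.
by rewrite gt_eqF.
Qed.

Lemma Ck_emb k (D : set (poct R * poct R)) i : open D -> Ck_on k (emb i) D.
Proof.
move=> oD; have Ci := Ck_on_id oD k.
by case: i; repeat apply: Ck_on_pair => //; (try exact: Ck_on_cst);
  (try exact: Ck_on_fst); exact: Ck_on_snd.
Qed.

Lemma Ck_coord (F : normedModType R) k (D : set F) (f : F -> otriple R) i : open D ->
  Ck_on k f D -> Ck_on k (fun x => coord i (f x)) D.
Proof.
move=> oD cf; case: i; [|apply: Ck_on_snd => //|].
- by do 2 apply: Ck_on_fst => //.
- exact: Ck_on_fst.
- exact: Ck_on_snd.
Qed.

Lemma Ck_rest (F : normedModType R) k (D : set F) (f : F -> otriple R) i : open D ->
  Ck_on k f D -> Ck_on k (fun x => rest i (f x)) D.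
Proof.
move=> oD cf.
have c1 := Ck_coord chart1 oD cf.
have c2 := Ck_coord chart2 oD cf.
have c3 := Ck_coord chart3 oD cf.
by case: i; exact: Ck_on_pair.
Qed.

Lemma emb_continuous i : continuous (emb i).
Proof. exact/C0_continuous/(Ck_emb _ _ openT). Qed.

Lemma coord_continuous i : continuous (coord i).
Proof. exact/C0_continuous/(Ck_coord _ openT)/Ck_on_id/openT. Qed.

Lemma rest_continuous i : continuous (rest i).
Proof. exact/C0_continuous/(Ck_rest _ openT)/Ck_on_id/openT. Qed.

Lemma coord_emb_norm_continuous i j : continuous (fun w => onorm2 (coord j (emb i w))).
Proof.
apply: C0_continuous; apply: Ck_on_onorm2; first exact: openT.
by apply: (Ck_coord _ openT); exact: Ck_emb openT.
Qed.

Lemma chart_range_open : open (@chart_range R).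
Proof.
have -> : @chart_range R = [set w | 0 < tnorm (emb chart1 w)].
  by apply/seteqP; split=> w; rewrite (chart_range_emb chart1).
apply: open_pos => w; apply: cvgD; first apply: cvgD.
- exact: (@coord_emb_norm_continuous chart1 chart1).
- exact: (@coord_emb_norm_continuous chart1 chart2).
- exact: (@coord_emb_norm_continuous chart1 chart3).
Qed.

End HomogeneousCoordinates.

(** * The quotient as a manifold *)

Definition separable_seq (R : realType) (E : normedModType R) (d : nat -> E) :=
  forall x (e : R), 0 < e -> exists n, `|x - d n| < e.

(** * Dense sequences in the model space *)

Section Separable.
Variable R : realType.

Lemma separable_seqR : exists d : nat -> R, separable_seq d.
Proof.
(* Codes of no rational give the default 0, which does not affect density. *)
exists (fun n => ratr (odflt 0 (unpickle n))) => x e e0.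
have /rat_in_itvoo[q /itvP qx] : x < x + e by rewrite ltrDl.
exists (pickle q); rewrite pickleK /= distrC ltr_distl qx andbT.
by rewrite (@le_lt_trans _ _ x) ?qx// gerBl ltW.
Qed.

Lemma separable_seqX (E F : normedModType R) :
  (exists d : nat -> E, separable_seq d) -> (exists d : nat -> F, separable_seq d) ->
  exists d : nat -> (E * F)%type, separable_seq d.
Proof.
move=> [d dP] [f fP].
exists (fun n => let p := odflt (0%N, 0%N) (unpickle n) in (d p.1, f p.2)).
move=> [x y] e e0; have [n nx] := dP x e e0; have [m my] := fP y e e0.
exists (pickle (n, m)); rewrite pickleK /= prod_normE /=.
by rewrite gt_max nx.
Qed.

Lemma separable_poct2 : exists d : nat -> (poct R * poct R)%type, separable_seq d.
Proof.
have s1 := separable_seqR.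
have s4 : exists d : nat -> quat R, separable_seq d by do 3 apply: separable_seqX => //.
by do 2 apply: separable_seqX => //.
Qed.

End Separable.

Section Quotient.
Variables (R : realType) (X : topologicalType) (pi : otriple R -> X).
Hypothesis pi_onto : forall y : X, exists a, @Ucal R a /\ pi a = y.
Hypothesis pi_eq : forall a b, @Ucal R a -> @Ucal R b -> (pi a = pi b <-> proj_equiv a b).
Hypothesis pi_top : forall V : set X,
  open V <-> exists O : set (otriple R), open O /\
                   @Ucal R `&` pi @^-1` V = @Ucal R `&` O.

Local Notation E := (poct R * poct R)%type.
Local Notation W := (@chart_range R).
Local Notation psi := (chart_inv pi).

Lemma psiE i w : psi i w = pi (emb i w). Proof. by case: i. Qed.

(** All questions about overlaps reduce to this: it gives both the domain and the formula of the
    transition map. *)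
Lemma chart_eqP i j w w' : W w -> W w' ->
  (psi i w = psi j w' <-> 0 < onorm2 (coord j (emb i w)) /\ w' = dehom j (emb i w)).
Proof.
move=> Ww Ww'; rewrite !psiE -proj_equiv_emb.
by apply: pi_eq; exact: Ucal_emb.
Qed.

Lemma in_chartP i j w : W w ->
  ((psi j @` W) (psi i w) <-> 0 < onorm2 (coord j (emb i w))).
Proof.
move=> Ww; split=> [[w' Ww' /esym /chart_eqP[]]//|h].
have Wd : W (dehom j (emb i w)) by apply: chart_range_dehom => //; apply/chart_range_emb.
by exists (dehom j (emb i w)) => //; apply/esym/chart_eqP.
Qed.

Lemma psi_inj i w w' : W w -> W w' -> psi i w = psi i w' -> w = w'.
Proof.
move=> Ww Ww' /(chart_eqP _ _ Ww Ww')[_ ->].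
by have [_ <-] := (chart_eqP i i Ww Ww).1 erefl.
Qed.

Lemma psi_cover x : exists i, (psi i @` W) x.
Proof.
have [a [Ua <-]] := pi_onto x; have [a0 [i ai]] := (UcalP a).1 Ua.
exists i, (rest i a); last by rewrite psiE emb_rest.
by apply/(chart_range_emb i); rewrite emb_rest.
Qed.

(* The slices [coord i = 1] are closed and cover [U], so openness can be tested
   on each of them. *)
Lemma open_chartsP (V : set X) :
  open V <-> forall i, open (W `&` psi i @^-1` V).
Proof.
split=> [/pi_top[Q [oQ UQ]] i|oV].
  have -> : W `&` psi i @^-1` V = W `&` (emb i @^-1` Q).
    apply/seteqP; split=> w [Ww] /=; rewrite psiE => h; split=> //.
      suff [] : (@Ucal R `&` Q) (emb i w) by [].
      by rewrite -UQ; split=> //; exact: Ucal_emb.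
    suff [] : (@Ucal R `&` pi @^-1` V) (emb i w) by [].
    by rewrite UQ; split=> //; exact: Ucal_emb.
  apply: openI; first exact: chart_range_open.
  by apply: open_comp => // w _; exact: emb_continuous.
apply/pi_top.
(* Off its slice [O i] imposes nothing; on it, the affine coordinates must lie in the given open set
   of chart [i]. *)
pose O i := [set t : otriple R | coord i t <> oone R] `|` (rest i @^-1` (W `&` psi i @^-1` V)).
have oO i : open (O i).
  apply: openU; last by apply: open_comp => // t _; exact: rest_continuous.
  have cl : closed [set oone R].
    by apply: accessible_closed_set1; apply: hausdorff_accessible; exact: norm_hausdorff.
  rewrite (_ : [set t | _] = coord i @^-1` (~` [set oone R]))//.
  by apply: open_comp; [move=> t _; exact: coord_continuous|exact: closed_openC].
exists (O chart1 `&` O chart2 `&` O chart3); split; first by do 2 apply: openI => //.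
apply/seteqP; split=> t [Ut].
  move=> Vt; split=> //.
  suff H i : O i t by [].
  have [e|e] := pselect (coord i t = oone R); last by left.
  have [t0 _] := (UcalP t).1 Ut.
  right; split; rewrite /= ?psiE ?emb_rest//.
  by apply/(chart_range_emb i); rewrite emb_rest.
move=> [[q1 q2] q3]; split=> //.
have H i : O i t by case: i.
have [_ [i ei]] := (UcalP t).1 Ut.
by have [//|[_]] := H i; rewrite /= psiE emb_rest.
Qed.

Lemma psi_continuous i : {within W, continuous (psi i)}.
Proof.
rewrite (continuous_open_subspace _ (@chart_range_open R)) => w; rewrite inE => Ww V.
rewrite nbhsE => -[Q [oQ Qw] QV].
have oQW := (open_chartsP Q).1 oQ i.
have : nbhs w (W `&` psi i @^-1` Q) by exact: open_nbhs_nbhs.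
by apply: filterS => u [_ /QV].
Qed.

Lemma dehom_Ck k i j : let D := [set w : E | W w /\ 0 < onorm2 (coord j (emb i w))] in
  open D /\ Ck_on k (fun w => dehom j (emb i w)) D.
Proof.
move=> D; have oD : open D.
  apply: openI; first exact: chart_range_open.
  by apply: open_pos; exact: coord_emb_norm_continuous.
split=> //; apply: Ck_rest => //.
have Ce := Ck_emb k i oD.
have Cc m : Ck_on k (fun w => coord m (emb i w)) D by exact: Ck_coord.
have Ci : Ck_on k (fun w => oinv (coord j (emb i w))) D.
  by apply: Ck_on_oinv => // w [_ h]; rewrite gt_eqF.
apply: Ck_on_pair => //; first apply: Ck_on_pair => //; apply: Ck_on_omul => //.
- exact: (Cc chart1).
- exact: (Cc chart2).
- exact: (Cc chart3).
Qed.

(** Seen in chart [j], the image of [V] is the preimage of [V] under the transition map, which is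
    continuous on the open overlap. *)
Lemma psi_open i (V : set E) : open V -> V `<=` W -> open (psi i @` V).
Proof.
move=> oV VW; apply/open_chartsP => j.
have [oD /(Ck_on0P oD) cD] := dehom_Ck 0 j i.
pose D := [set w : E | W w /\ 0 < onorm2 (coord i (emb j w))].
have -> : W `&` psi j @^-1` (psi i @` V) = D `&` (fun w => dehom i (emb j w)) @^-1` V.
  apply/seteqP; split=> w.
    move=> [Ww [v Vv /esym]] /chart_eqP[//||h e]; first exact: VW.
    by split=> //=; rewrite -e.
  move=> [[Ww h] Vd]; split=> //; exists (dehom i (emb j w)) => //.
  by apply/esym/chart_eqP => //; exact: VW.
rewrite openE => w [Dw Vw].
have nD : nbhs w D by exact: open_nbhs_nbhs.
have nV : nbhs w ((fun w => dehom i (emb j w)) @^-1` V).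
  by apply: cD => //; exact: open_nbhs_nbhs.
exact: filterI.
Qed.

Lemma quotient_hausdorff : hausdorff_space X.
Proof.
have hE : hausdorff_space E by exact: norm_hausdorff.
have same j w w' : W w -> W w' -> psi j w != psi j w' -> exists2 AB : set X * set X,
    (psi j w \in AB.1 /\ psi j w' \in AB.2) &
    [/\ open AB.1, open AB.2 & AB.1 `&` AB.2 == set0].
  move=> Ww Ww' ne.
  have : w != w' by apply: contra_neq ne => ->.
  move: hE; rewrite open_hausdorff => /[apply] -[[A B] /= []].
  rewrite !inE => Aw Bw [oA oB AB0].
  exists (psi j @` (A `&` W), psi j @` (B `&` W)) => /=.
    by rewrite !inE; split; [exists w|exists w'].
  split.
  - by apply: psi_open; [apply: openI => //; exact: chart_range_open|move=> ? []].
  - by apply: psi_open; [apply: openI => //; exact: chart_range_open|move=> ? []].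
  - apply/eqP/seteqP; split=> // z [[u [Au Wu] <-] [v [Bv Wv] e]].
    have uv : v = u by exact: psi_inj e.
    by have : (A `&` B) u; [split=> //; rewrite -uv|rewrite AB0].
rewrite open_hausdorff => x y ne.
have [i [w Ww ew]] := psi_cover x; have [j [w' Ww' ew']] := psi_cover y.
have [hx|hx] := pselect ((psi j @` W) x).
  by case: hx => v Wv ev; move: ne; rewrite -ev -ew'; exact: same.
have [hy|hy] := pselect ((psi i @` W) y).
  by case: hy => v Wv ev; move: ne; rewrite -ev -ew; exact: same.
(* A point of chart [i] outside chart [j] has j-th coordinate of norm at most 0, hence lies over
   [N i j]. *)
pose N (i j : chart_index) := [set v : E | W v /\ 0 < 1 - onorm2 (coord j (emb i v))].
have oN k l : open (N k l).
  apply: openI; first exact: chart_range_open.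
  by apply: open_pos => v; apply: cvgB; [exact: cvg_cst|exact: coord_emb_norm_continuous].
exists (psi i @` (N i j), psi j @` (N j i)) => /=.
  rewrite !inE; split; [exists w|exists w'] => //; split=> //.
    move: hx; rewrite -ew in_chartP// => /negP.
    by rewrite -leNgt subr_gt0 => /le_lt_trans; apply.
  move: hy; rewrite -ew' in_chartP// => /negP.
  by rewrite -leNgt subr_gt0 => /le_lt_trans; apply.
split; [by apply: psi_open => // v []|by apply: psi_open => // v []|].
apply/eqP/seteqP; split=> // z [[u [Wu hu] <-] [v [Wv hv] /esym e]].
have [c0 ev] := (chart_eqP _ _ Wu Wv).1 e.
have E1 : coord i (emb j v) = omul (coord i (emb i u)) (oinv (coord j (emb i u))).
  by rewrite ev emb_dehom// coord_tmul.
move: hv; rewrite /= E1 coord_emb omul1o => hv.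
(* A common point would give norms [a] and [b] with [a b = 1], [0 < a < 1] and [b < 1]. *)
have := omulV (lt0r_neq0 c0) => /(congr1 (@onorm2 R)); rewrite onorm2M onorm2_one.
move: hu hv c0 => /=; set a := onorm2 _; set b := onorm2 _; nra.
Qed.

Lemma quotient_second_countable : Defs.second_countable X.
Proof.
have [d dP] := separable_poct2 R.
(* A basic set is coded by a chart, a centre and a radius [1/(n+1)], which is never 0. *)
pose ch (n : nat) := match n with 0%N => chart1 | 1%N => chart2 | _ => chart3 end.
pose B (n : nat) := let p := odflt (0%N, 0%N, 0%N) (unpickle n) in
  psi (ch p.1.1) @` (W `&` ball (d p.1.2) (p.2.+1%:R^-1 : R)).
have oB : forall n, open (B n).
  move=> n; apply: psi_open; last by move=> ? [].
  by apply: openI; [exact: chart_range_open|exact: ball_open].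
exists B; split=> // V oV x Vx.
have [i [w Ww wx]] := psi_cover x.
have oi := (open_chartsP V).1 oV i.
have /nbhs_normP[e /= e0 He] : nbhs w (W `&` psi i @^-1` V).
  by apply: open_nbhs_nbhs; split=> //; split=> //=; rewrite wx.
have e20 : 0 < e / 2 by rewrite divr_gt0.
(* With radius below [e / 2] and the centre within that radius of [w], the ball contains [w] and
   stays within [e] of it. *)
have [m _ Hm] := near_infty_natSinv_lt (PosNum e20).
have {Hm} me : m.+1%:R^-1 < e / 2 := Hm m (leqnn m).
have m0 : (0 : R) < m.+1%:R^-1 by rewrite invr_gt0.
have [n wn] := dP w _ m0.
have [q qi] : exists q, ch q = i.
  by case: i {wx oi He} => //; [exists 0%N|exists 1%N|exists 2%N].
exists (pickle (q, n, m)); rewrite /B pickleK /= qi; split.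
  by exists w => //; split=> //; rewrite -ball_normE /= distrC.
move=> _ [v [Wv] + <-]; rewrite -ball_normE /= => nv.
suff [] : (W `&` psi i @^-1` V) v by [].
apply: He => /=; rewrite (le_lt_trans (ler_distD (d n) w v))//.
by rewrite (splitr e) ltrD// (lt_trans _ me).
Qed.

Lemma quotient_smooth_manifold :
  smooth_manifold_with_atlas (fun _ : chart_index => W) psi.
Proof.
split.
- exact: quotient_hausdorff.
- exact: quotient_second_countable.
- by move=> y; have [i [w Ww e]] := psi_cover y; exists i, w.
- move=> i; split; first exact: chart_range_open.
  split; first exact: psi_inj.
  by split; [exact: psi_continuous|exact: psi_open].
- move=> i j; exists (fun w => dehom j (emb i w)).
  have -> : [set w | W w /\ exists w', W w' /\ psi j w' = psi i w] =
      [set w : E | W w /\ 0 < onorm2 (coord j (emb i w))].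
    apply/seteqP; split=> w [Ww h]; split=> //.
      by apply/in_chartP => //; case: h => v [Wv e]; exists v.
    by have [v Wv e] := (in_chartP i j Ww).2 h; exists v.
  split=> [w [Ww h]|k]; last by have [] := dehom_Ck k i j.
  have Wd : W (dehom j (emb i w)).
    by apply: chart_range_dehom => //; apply/chart_range_emb.
  by split=> //; apply/esym/chart_eqP.
Qed.

End Quotient.

(** * Tethers *)

(** Paths are defined on the whole line and constant beyond both ends, as is required of tethers. *)
Definition joined (R : realType) (E : normedModType R) (S : set E) (a b : E) :=
  exists c : R -> E, [/\ continuous c, forall t, t <= 0 -> c t = a,
    forall t, 1 <= t -> c t = b & forall t, S (c t)].

Section Joined.
Variable R : realType.

Lemma joined_segment (E : normedModType R) (S : set E) a b :
  (forall k : R, 0 <= k <= 1 -> S ((1 - k) *: a + k *: b)) -> joined S a b.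
Proof.
move=> Sab; exists (fun t => (1 - clamp t) *: a + clamp t *: b); split.
- move=> t; apply: cvgD; apply: cvgZ; try exact: cvg_cst; last exact: continuous_clamp.
  by apply: cvgB; [exact: cvg_cst|exact: continuous_clamp].
- by move=> t t0; rewrite clamp_le0// subr0 scale1r scale0r addr0.
- by move=> t t1; rewrite clamp_ge1// subrr scale1r scale0r add0r.
- by move=> t; apply: Sab; exact: clamp_itv.
Qed.

(** The concatenation is written without cases: on each half of the interval one of the two terms
    equals [b] and cancels against [- b]. *)
Lemma joined_trans (E : normedModType R) (S : set E) a b d :
  joined S a b -> joined S b d -> joined S a d.
Proof.
move=> [f [cf f0 f1 Sf]] [g [cg g0 g1 Sg]].
exists (fun t => f (2 * t) + g (2 * t - 1) - b); split.
- move=> t; apply: cvgB; last exact: cvg_cst.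
  have c2 : continuous (fun t : R => 2 * t) by move=> s; apply: cvgMr; exact: cvg_id.
  apply: cvgD; first by apply: (@continuous_comp _ _ _ _ f); [exact: c2|exact: cf].
  apply: (@continuous_comp _ _ _ (fun t : R => 2 * t - 1) g); last exact: cg.
  by apply: cvgB; [exact: c2|exact: cvg_cst].
- by move=> t t0; rewrite f0 ?g0 ?addrK//; lra.
- by move=> t t1; rewrite f1 ?g1 1?addrC ?addrA ?addNr ?add0r//; lra.
- move=> t; have [t2|t2] := leP t (1 / 2).
    by rewrite g0 ?addrK//; lra.
  by rewrite f1 1?addrC ?addKr//; lra.
Qed.

Lemma joined_sub (E : normedModType R) (S S' : set E) a b :
  S `<=` S' -> joined S a b -> joined S' a b.
Proof. by move=> SS' [f [cf f0 f1 Sf]]; exists f; split=> // t; exact: SS'. Qed.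

Lemma joined_pair (E F : normedModType R) (S : set E) (T : set F) a b a' b' :
  joined S a a' -> joined T b b' -> joined (S `*` T) (a, b) (a', b').
Proof.
move=> [f [cf f0 f1 Sf]] [g [cg g0 g1 Sg]].
exists (fun t => (f t, g t)); split => [t|t h|t h|t].
- exact: (cvg_pair (cf t) (cg t)).
- by rewrite f0 ?g0.
- by rewrite f1 ?g1.
- by split; [exact: Sf|exact: Sg].
Qed.

Lemma onorm2Z (k : R) (x : poct R) : onorm2 (k *: x) = k ^+ 2 * onorm2 x.
Proof.
move: x => [[[[a b] c] d] [[[e f] g] h]].
rewrite [k *: _](_ : _ = ((k * a, k * b, k * c, k * d), (k * e, k * f, k * g, k * h)))//.
by rewrite !onorm2E; ring.
Qed.

Lemma segment_octE (k a b c d e f g h a' b' c' d' e' f' g' h' : R) :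
  (1 - k) *: (((a, b, c, d), (e, f, g, h)) : poct R)
    + k *: ((a', b', c', d'), (e', f', g', h')) =
  (((1 - k) * a + k * a', (1 - k) * b + k * b', (1 - k) * c + k * c', (1 - k) * d + k * d'),
   ((1 - k) * e + k * e', (1 - k) * f + k * f', (1 - k) * g + k * g', (1 - k) * h + k * h')).
Proof. by []. Qed.

(* Kill the second quaternion, then join the first to 1 through i or -i, the sign
   being chosen so that the segments avoid 0. *)
Lemma joined_one (u : poct R) : Opos u -> joined (@Opos R) u (oone R).
Proof.
move: u => [[[[a b] c] d] [[[e f] g] h]]; rewrite /Opos /= onorm2E => u0.
(* The segment to [s i] has the cross term [2 k (1 - k) s b] in its norm, which this sign makes
   nonnegative. *)
pose s : R := if 0 <= b then 1 else -1.
have sb : 0 <= s * b by rewrite /s; case: (leP 0 b) => ?; lra.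
have s2 : s ^+ 2 = 1 by rewrite /s; case: ifP => _; ring.
have q0 : 0 <= e ^+ 2 + f ^+ 2 + g ^+ 2 + h ^+ 2 by rewrite !addr_ge0 ?sqr_ge0.
apply: (@joined_trans _ _ _ ((a, b, c, d), (0, 0, 0, 0))).
  apply: joined_segment => k /andP[k0 k1]; rewrite segment_octE /Opos /= onorm2E.
  rewrite [ltRHS](_ : _ = a ^+ 2 + b ^+ 2 + c ^+ 2 + d ^+ 2
     - (1 - k) ^+ 2 * (e ^+ 2 + f ^+ 2 + g ^+ 2 + h ^+ 2)); last by ring.
  set q := e ^+ 2 + f ^+ 2 + g ^+ 2 + h ^+ 2 in q0 *.
  have uq : 0 < a ^+ 2 + b ^+ 2 + c ^+ 2 + d ^+ 2 - q by rewrite /q; lra.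
  have : (1 - k) ^+ 2 * q <= 1 * q by apply: ler_wpM2r => //; nra.
  by move: uq; lra.
apply: (@joined_trans _ _ _ ((0, s, 0, 0), (0, 0, 0, 0))).
  apply: joined_segment => k /andP[k0 k1]; rewrite segment_octE /Opos /= onorm2E.
  have p0 : 0 < a ^+ 2 + b ^+ 2 + c ^+ 2 + d ^+ 2 by lra.
  rewrite [ltRHS](_ : _ = (1 - k) ^+ 2 * (a ^+ 2 + b ^+ 2 + c ^+ 2 + d ^+ 2)
     + 2 * (k * (1 - k)) * (s * b) + k ^+ 2 * s ^+ 2); last by ring.
  rewrite s2 mulr1.
  have k1' : 0 <= 1 - k by rewrite subr_ge0.
  have h1 : 0 <= 2 * (k * (1 - k)) * (s * b) by do 3 apply: mulr_ge0 => //.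
  move: p0; set p := a ^+ 2 + _ + _ + _ => p0.
  have [->|kn] := eqVneq k 0; first by rewrite subr0 !expr2; nra.
  have : 0 < k ^+ 2 by rewrite exprn_gt0// lt_neqAle eq_sym kn.
  have : 0 <= (1 - k) ^+ 2 * p by rewrite mulr_ge0 ?sqr_ge0// ltW.
  lra.
apply: joined_segment => k /andP[k0 k1]; rewrite segment_octE /Opos /= onorm2E.
rewrite [ltRHS](_ : _ = k ^+ 2 + (1 - k) ^+ 2 * s ^+ 2); last by ring.
by rewrite s2; nra.
Qed.

(** Coordinates of non-positive norm are first shrunk to 0, which never lowers their norm. Then both
    norms are nonnegative, the chart condition is automatic, and the coordinates move to 1
    independently. Positive norms stay positive, so the path leaves no chart that contains its
    start. *)
Lemma joined_chart (u v : poct R) : chart_range (u, v) ->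
  joined [set w : poct R * poct R | chart_range w /\
     (0 < onorm2 u -> 0 < onorm2 w.1) /\ (0 < onorm2 v -> 0 < onorm2 w.2)]
    (u, v) (oone R, oone R).
Proof.
rewrite /chart_range /= => uv.
pose pos (x : poct R) := if 0 < onorm2 x then x else 0.
have posP x k : 0 <= k <= 1 ->
    onorm2 x <= onorm2 ((1 - k) *: x + k *: pos x) /\
    (0 < onorm2 x -> 0 < onorm2 ((1 - k) *: x + k *: pos x)).
  move=> /andP[k0 k1]; rewrite /pos; case: ifPn => x0 /=.
    by rewrite -scalerDl subrK scale1r.
  rewrite scaler0 addr0 onorm2Z; rewrite -leNgt in x0.
  have h1 : (1 - k) ^+ 2 <= 1 by nra.
  by split=> [|h]; [nra|lra].
(* If [x] has non-positive norm, the path is the segment from 0 to 1, of norm [k^2], and the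
   implication is vacuous. *)
have posJ x :
    joined [set y | 0 <= onorm2 y /\ (0 < onorm2 x -> 0 < onorm2 y)] (pos x) (oone R).
  rewrite /pos; case: ifPn => x0.
    by apply: joined_sub (joined_one x0) => y y0; split=> [|_]; [exact: ltW|].
  apply: joined_segment => k /andP[k0 k1].
  rewrite scaler0 add0r /= onorm2Z onorm2_one mulr1 sqr_ge0.
  by split=> // x1; rewrite x1 in x0.
apply: (@joined_trans _ _ _ (pos u, pos v)).
  apply: joined_segment => k k01.
  have [u1 u2] := posP u k k01; have [v1 v2] := posP v k k01.
  split; last by split; [exact: u2|exact: v2].
  apply: (lt_le_trans uv); apply: lerD; last exact: v1.
  by apply: lerD; [exact: lexx|exact: u1].
apply: joined_sub (joined_pair (posJ u) (posJ v)) => -[x y] [/= [x0 ux] [y0 vy]].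
by split=> //=; lra.
Qed.

(** The scaled quantity is the convex combination, with weight [k^2], of 1 and the original positive
    one. *)
Lemma chart_range_star (w : poct R * poct R) (k : R) :
  chart_range w -> 0 <= k <= 1 -> chart_range (k *: w).
Proof.
case: w => u v; rewrite /chart_range /= !onorm2Z => h /andP[k0 k1].
have -> : 1 + k ^+ 2 * onorm2 u + k ^+ 2 * onorm2 v =
  (1 - k ^+ 2) + k ^+ 2 * (1 + onorm2 u + onorm2 v) by ring.
have [->|kn] := eqVneq k 0; first by rewrite expr0n /= mul0r subr0 addr0.
have k2 : 0 < k ^+ 2 by rewrite exprn_gt0// lt_neqAle eq_sym kn.
have : k ^+ 2 <= 1 by rewrite expr_le1.
have : 0 < k ^+ 2 * (1 + onorm2 u + onorm2 v) by rewrite mulr_gt0.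
lra.
Qed.

End Joined.

(* X together with pi : U -> X is (a realisation of) the quotient space
   O'P^2 = U/~ : pi is onto, identifies exactly ~-equivalent points of U,
   and X carries the quotient of the subspace topology of U in O'^3. *)
Theorem theorem6p3 (R : realType) (X : topologicalType) (pi : otriple R -> X) :
  (forall y : X, exists a, @Ucal R a /\ pi a = y) ->
  (forall a b, @Ucal R a -> @Ucal R b -> (pi a = pi b <-> proj_equiv a b)) ->
  (forall V : set X,
      open V <-> exists O : set (otriple R), open O /\
                   @Ucal R `&` pi @^-1` V = @Ucal R `&` O) ->
  smooth_manifold_with_atlas (fun _ : chart_index => @chart_range R)
                             (chart_inv pi)
  /\ simply_connected R X.
Proof.
move=> pi_onto pi_eq pi_top; split; first exact: quotient_smooth_manifold.
apply: (@star_charts_simply_connected R X (poct R * poct R)%type chart_index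
  (@chart_range R) (chart_inv pi) _ _ _ _ _ (pi (oone R, oone R, oone R))).
- exact: chart_range_star.
- exact: psi_inj.
- exact: psi_continuous.
- exact: psi_open.
- exact: chart_range_open.
- exact: psi_cover.
move=> x; have [i [[u v] Ww <-]] := psi_cover pi_onto x.
have [c [cc c0 c1 cS]] := joined_chart Ww.
exists (chart_inv pi i \o c); split.
- by apply: (continuous_within_comp (@psi_continuous _ _ _ pi_top i)) => // t; case: (cS t).
- by move=> t t0; rewrite /= c0.
(* The pair [(1, 1)] represents [[1,1,1]] in all three charts. *)
- by move=> t t1; rewrite /= c1//; case: (i).
(* Lying in chart [j] is positivity of the j-th norm, which [cS] preserves for the two affine
   coordinates; the remaining one is constantly 1. *)
- move=> j /(in_chartP pi_eq i j Ww) h t; have [Wt [h1 h2]] := cS t.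
  apply/(in_chartP pi_eq i j Wt).
  by case: (i) (j) h => [] [] /=; rewrite ?onorm2_one.
Qed.
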